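(* Let $\mathbf{w}$ be a Rote word (an infinite binary word having exactly $2n$ distinct factors of length $n$ for every $n\ge 1$) that avoids $(5/2)^+$-powers. Then exactly one of the following four cases holds: \begin{enumerate} \item The set of length-4 factors of $\mathbf{w}$ is $F$, and for every positive integer $n$, some final segment of $\mathbf{w}$ has the form $g(f^n(\mathbf{u}))$ for some proper $\mathbf{u}\in\Sigma_3^\omega$. \item The set of length-4 factors of $\mathbf{w}$ is $\overline{F}$, and for every positive integer $n$, some final segment of $\mathbf{w}$ has the form $\overline{g(f^n(\mathbf{u}))}$ for some proper $\mathbf{u}\in\Sigma_3^\omega$. \item The set of length-4 factors of $\mathbf{w}$ is $F^R$, and for every positive integer $n$, some final segment of $\mathbf{w}$ has the form $g(h^n(\mathbf{u}))$ for some antiproper $\mathbf{u}\in\Sigma_3^\omega$. \item The set of length-4 factors of $\mathbf{w}$ is $\overline{F^R}$, and for every positive integer $n$, some final segment of $\mathbf{w}$ has the form $\overline{g(h^n(\mathbf{u}))}$ for some antiproper $\mathbf{u}\in\Sigma_3^\omega$. \end{enumerate}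
   Context: $\Sigma_2=\{0,1\}$, $\Sigma_3=\{0,1,2\}$. For a finite word $w$ of length $\ell$ with smallest period $p$, its exponent is $\ell/p$; a $(5/2)^+$-power is a word of exponent $>5/2$; a word avoids $(5/2)^+$-powers if none of its factors is a $(5/2)^+$-power. Let $F=\{0110,1001,0011,1100,0010,0100,1101,1010\}$. For a binary word $w$, $\overline{w}$ is its complement (exchange $0$ and $1$) and $w^R$ its reversal; these are extended to sets of words elementwise, and complement is applied letterwise to infinite words. Morphisms: $g:\Sigma_3^*\to\Sigma_2^*$ with $g(0)=011,\ g(1)=0,\ g(2)=01$; $f:\Sigma_3^*\to\Sigma_3^*$ with $f(0)=0121,\ f(1)=021,\ f(2)=01$; $h:\Sigma_3^*\to\Sigma_3^*$ with $h(0)=1210,\ h(1)=120,\ h(2)=10$; all extended to infinite words. Parikh vector $\pi(u)=[|u|_0,|u|_1,|u|_2]$; $\pi(x)>\pi(y)$ means $|x|_i\ge|y|_i$ for all $i$ with strict inequality for some $i$. A finite $u\in\Sigma_3^*$ is proper if it has no factor $xyxyx$ with $\pi(x)>\pi(y)$ and none of $00,11,22,20,10101,2121,10210210$ is a factor of $u$; an infinite word over $\Sigma_3$ is proper if all its finite factors are proper. A finite word is antiproper if its reversal is proper; an infinite word is antiproper if all its finite factors are antiproper. A final segment of an infinite word is a suffix of it. *)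

(* Defs.v *)
From mathcomp Require Import all_boot all_order all_algebra.
From mathcomp Require Import classical_sets functions cardinality.

Set Implicit Arguments.
Unset Strict Implicit.
Unset Printing Implicit Defensive.

Local Open Scope classical_set_scope.
Local Open Scope card_scope.

Definition infword (A : Type) := nat -> A.

Definition final_segment (A : Type) (k : nat) (w : infword A) : infword A :=
  fun i => w (k + i).

Definition infprefix (A : Type) (n : nat) (w : infword A) : seq A := mkseq w n.

Definition factors (A : Type) (w : infword A) (n : nat) : set (seq A) :=
  range (fun k => infprefix n (final_segment k w)).

Definition complement (w : infword bool) : infword bool := fun i => ~~ w i.

Definition Rote (w : infword bool) : Prop :=
  forall n, 0 < n -> factors w n #= `I_(2 * n).

Definition is_period (A : eqType) (w : seq A) (p : nat) : bool :=
  (0 < p) && (drop p w == take (size w - p) w).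

Lemma ex_period (A : eqType) (w : seq A) : exists p, is_period w p.
Proof.
by exists (size w).+1; rewrite /is_period drop_oversize // subnS subnn take0 eqxx.
Qed.

(* For nonempty w this is at most size w, which is always a period; the empty
   word gets smallest period 1, hence exponent 0. *)
Definition smallest_period (A : eqType) (w : seq A) : nat := ex_minn (ex_period w).

Definition exponent (A : eqType) (w : seq A) : rat :=
  ((size w)%:R / (smallest_period w)%:R)%R.

Definition avoids_plus_powers (A : eqType) (e : rat) (w : infword A) : Prop :=
  forall n s, factors w n s -> ~ (e < exponent s)%R.

Definition morphism (A B : Type) (m : A -> seq B) (w : seq A) : seq B :=
  flatten (map m w).

(* Image of an infinite word under a nonerasing morphism: since every m a is
   nonempty, the image of the prefix of length i.+1 has a letter at position i,
   so the default letter b0 is never reached. *)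
Definition inf_morphism (A B : Type) (b0 : B) (m : A -> seq B)
    (u : infword A) : infword B :=
  fun i => nth b0 (morphism m (infprefix i.+1 u)) i.

Definition word2 : seq nat -> seq bool := map (fun k => k != 0).
Definition word3 : seq nat -> seq 'I_3 := map (fun k => inZp k).

Definition on_letters (B : Type) (w0 w1 w2 : seq B) (a : 'I_3) : seq B :=
  match val a with 0 => w0 | 1 => w1 | _ => w2 end.

Definition g_letter : 'I_3 -> seq bool :=
  on_letters (word2 [:: 0; 1; 1]) (word2 [:: 0]) (word2 [:: 0; 1]).

Definition f_letter : 'I_3 -> seq 'I_3 :=
  on_letters (word3 [:: 0; 1; 2; 1]) (word3 [:: 0; 2; 1]) (word3 [:: 0; 1]).

Definition h_letter : 'I_3 -> seq 'I_3 :=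
  on_letters (word3 [:: 1; 2; 1; 0]) (word3 [:: 1; 2; 0]) (word3 [:: 1; 0]).

Definition g : infword 'I_3 -> infword bool := inf_morphism false g_letter.
Definition f : infword 'I_3 -> infword 'I_3 := inf_morphism ord0 f_letter.
Definition h : infword 'I_3 -> infword 'I_3 := inf_morphism ord0 h_letter.

Definition F : set (seq bool) :=
  [set` map word2 [:: [:: 0; 1; 1; 0]; [:: 1; 0; 0; 1];
                      [:: 0; 0; 1; 1]; [:: 1; 1; 0; 0];
                      [:: 0; 0; 1; 0]; [:: 0; 1; 0; 0];
                      [:: 1; 1; 0; 1]; [:: 1; 0; 1; 0]]].

Definition complements (S : set (seq bool)) : set (seq bool) := map negb @` S.
Definition reversals (S : set (seq bool)) : set (seq bool) := rev @` S.

Definition parikh (u : seq 'I_3) (i : 'I_3) : nat := count_mem i u.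

Definition parikh_gt (x y : seq 'I_3) : Prop :=
  (forall i, parikh y i <= parikh x i) /\ (exists i, parikh y i < parikh x i).

Definition forbidden : seq (seq 'I_3) :=
  map word3 [:: [:: 0; 0]; [:: 1; 1]; [:: 2; 2]; [:: 2; 0];
                [:: 1; 0; 1; 0; 1]; [:: 2; 1; 2; 1];
                [:: 1; 0; 2; 1; 0; 2; 1; 0]].

Definition proper (u : seq 'I_3) : Prop :=
  (forall x y, infix (x ++ y ++ x ++ y ++ x) u -> ~ parikh_gt x y) /\
  (forall v, v \in forbidden -> ~~ infix v u).

Definition antiproper (u : seq 'I_3) : Prop := proper (rev u).

Definition inf_proper (u : infword 'I_3) : Prop :=
  forall n s, factors u n s -> proper s.

Definition inf_antiproper (u : infword 'I_3) : Prop :=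
  forall n s, factors u n s -> antiproper s.

Definition exactly_one_of_four (A B C D : Prop) : Prop :=
  (A \/ B \/ C \/ D) /\
  ~ (A /\ B) /\ ~ (A /\ C) /\ ~ (A /\ D) /\
  ~ (B /\ C) /\ ~ (B /\ D) /\ ~ (C /\ D).

(* Main.v *)
(* A Rote word avoiding (5/2)+-powers has at most 2n factors of each length n, so
   backtracking applies. Extending the factor 00 to the right, the bounds for
   n = 4 and n = 8 force all eight words of F, or of one of its three variants, to
   occur within 52 letters. When the factors of length 4 are those of F, the word
   parses into the blocks of g, and the preimage is proper: a forbidden xyxyx would
   give a power of exponent > 5/2, and each forbidden short word v makes the
   extensions of g(v)0 to the left die out (the bound for n = 6 is needed only for
   v = 2121). Proper words in turn parse into blocks of f, and the preimage is again
   proper because, for v forbidden, f(v)0 has no proper extension by three letters to the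
   left; the
   counting hypothesis is no longer used, so this step can be iterated. The other
   cases follow by complementing, and by reversing finite words: for every word s,
   the reversal of g(s)0 is g(s^R)0 and that of 0h(s) is f(s^R)0. *)
From Pilot Require Import Defs.
From mathcomp Require Import all_boot all_order all_algebra.
From mathcomp Require Import boolp classical_sets functions cardinality.
From mathcomp Require Import zify.
(* [classical_sets] also defines a [proper]. *)
Import Pilot.Defs.

Set Implicit Arguments.
Unset Strict Implicit.
Unset Printing Implicit Defensive.

Local Open Scope classical_set_scope.
Local Open Scope card_scope.

(** * Counting and factors of infinite words *)

Lemma uniq_card_le (T : eqType) (A : set T) (m : nat) (s : seq T) :
  A #= `I_m -> uniq s -> (forall x, x \in s -> A x) -> size s <= m.
Proof.
case: s => [|x0 s'] // cA us sA; set s := x0 :: s' in us sA *.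
have inj : {in `I_(size s) &, injective (nth x0 s)}.
  by move=> i j; rewrite !inE /= => li lj /eqP; rewrite nth_uniq // => /eqP.
have := inj_card_eq inj; rewrite card_eq_le => /andP[_ leI].
rewrite -card_le_II -(card_le_eqr cA); apply: card_le_trans leI _.
by apply: subset_card_le => _ [i li <-]; apply/sA/mem_nth.
Qed.

Definition window (A : Type) (w : infword A) (k n : nat) : seq A :=
  infprefix n (final_segment k w).

Definition lang (A : eqType) (w : infword A) (s : seq A) : Prop :=
  exists k, s = window w k (size s).

Section Windows.
Variables (A : eqType) (w : infword A).

Lemma size_window k n : size (window w k n) = n.
Proof. exact: size_mkseq. Qed.

Lemma nth_window x0 k n i : i < n -> nth x0 (window w k n) i = w (k + i).
Proof. exact: nth_mkseq. Qed.

Lemma window_cat k m n : window w k (m + n) = window w k m ++ window w (k + m) n.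
Proof.
apply: (@eq_from_nth _ (w 0)) => [|i]; rewrite ?size_cat !size_window // => lti.
rewrite nth_cat size_window nth_window //; case: ltnP => h; rewrite nth_window //.
  by congr w; lia.
by lia.
Qed.

Lemma window1 k : window w k 1 = [:: w k].
Proof. by rewrite /window /infprefix /mkseq /= /final_segment addn0. Qed.

Lemma window_lang k n : lang w (window w k n).
Proof. by exists k; rewrite size_window. Qed.

Lemma factors_lang n s : factors w n s <-> lang w s /\ size s = n.
Proof.
split=> [[k _ <-]|[[k ->] <-]]; last by exists k => //; rewrite size_window.
by split; [exact: window_lang | exact: size_window].
Qed.

Lemma lang_infix s t : infix s t -> lang w t -> lang w s.
Proof.
move=> /infixP[a [b ->]] [k]; rewrite !size_cat window_cat window_cat.
move=> /eqP; rewrite eqseq_cat ?size_window // => /andP[_].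
rewrite eqseq_cat ?size_window // => /andP[/eqP -> _]; exact: window_lang.
Qed.

End Windows.

(** * Images of infinite words under morphisms, and desubstitution *)

Lemma morphism_cat (A B : Type) (m : A -> seq B) s t :
  morphism m (s ++ t) = morphism m s ++ morphism m t.
Proof. by rewrite /morphism map_cat flatten_cat. Qed.

Lemma morphism_seq1 (A B : Type) (m : A -> seq B) a : morphism m [:: a] = m a.
Proof. exact: cats0. Qed.

Section Morphisms.
Variables (A B : eqType) (b0 : B) (m : A -> seq B).
Hypothesis m_gt0 : forall a, 0 < size (m a).

Lemma size_morphism_ge s : size s <= size (morphism m s).
Proof.
elim: s => //= a s IHs; rewrite /morphism /= size_cat -/(morphism m s).
by have := m_gt0 a; lia.
Qed.

Lemma inf_morphism_eq (u : infword A) (x : infword B) :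
  (forall n, window x 0 (size (morphism m (window u 0 n)))
             = morphism m (window u 0 n)) ->
  x = inf_morphism b0 m u.
Proof.
move=> xP; apply/funext => i; rewrite /inf_morphism.
have -> : infprefix i.+1 u = window u 0 i.+1 by [].
rewrite -xP nth_window //.
by apply: leq_trans (size_morphism_ge _); rewrite size_window.
Qed.

(** The images of the prefixes of [u] are nested, so a letter of the infinite image can be read off
    any long enough one. *)
Lemma window_inf_morphism (u : infword A) k n :
  window (inf_morphism b0 m u) (size (morphism m (window u 0 k)))
    (size (morphism m (window u k n))) = morphism m (window u k n).
Proof.
pose M i := morphism m (window u 0 i).
have MS i j : exists t, M (i + j) = M i ++ t.
  by rewrite /M window_cat morphism_cat; eexists.
have nthM i j : i < size (M j) -> inf_morphism b0 m u i = nth b0 (M j) i.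
  move=> lti; rewrite /inf_morphism -/(infprefix _ _).
  have -> : infprefix i.+1 u = window u 0 i.+1 by [].
  have lti' : i < size (M i.+1).
    by apply: leq_trans (size_morphism_ge _); rewrite size_window.
  rewrite -/(M i.+1); case/orP: (leq_total i.+1 j) => /subnKC <-.
    by have [t ->] := MS i.+1 (j - i.+1); rewrite nth_cat lti'.
  by have [t ->] := MS j (i.+1 - j); rewrite nth_cat lti.
apply: (@eq_from_nth _ b0) => [|i]; rewrite size_window // => lti.
rewrite nth_window // (nthM _ (k + n)); last first.
  by rewrite /M window_cat morphism_cat size_cat ltn_add2l.
by rewrite /M window_cat morphism_cat nth_cat ltnNge leq_addr addKn.
Qed.

Lemma final_inf_morphism (u : infword A) k :
  final_segment (size (morphism m (window u 0 k))) (inf_morphism b0 m u)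
  = inf_morphism b0 m (final_segment k u).
Proof.
apply: inf_morphism_eq => n.
have -> : window (final_segment k u) 0 n = window u k n by [].
by rewrite -[RHS](window_inf_morphism u k n).
Qed.

(** [Q] marks the cuts between blocks. Besides the preimage [u], the lemma records that the image of
    each factor of [u] occurs in [w] between two cuts not before [k0]; these cuts later supply the
    letters around the image. *)
Lemma desubstitution (Q : pred nat) (w : infword B) (k0 : nat) :
  Q k0 ->
  (forall k, Q k ->
     exists2 a, window w k (size (m a)) = m a & Q (k + size (m a))) ->
  exists2 u, final_segment k0 w = inf_morphism b0 m u &
  forall i n, let s := morphism m (window u i n) in
  exists j, [/\ k0 <= j, Q j, Q (j + size s) & window w j (size s) = s].
Proof.
move=> Qk0 step.
have [a0 _ _] := step _ Qk0.
(* Away from the cuts [a0] is a dummy value, so that choice gives a total function. *)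
have step' k : exists a, Q k ->
    window w k (size (m a)) = m a /\ Q (k + size (m a)).
  have [/step[a ea Qa]|nQ] := boolP (Q k); first by exists a.
  by exists a0.
have [next nextP] := choice step'.
pose pos := fix pos i := if i is i'.+1 then pos i' + size (m (next (pos i')))
                         else k0.
pose u : infword A := fun i => next (pos i).
have Qpos i : Q (pos i) by elim: i => //= i /nextP[].
have posD i n : pos (i + n) = pos i + size (morphism m (window u i n)).
  elim: n => [|n IHn]; first by rewrite !addn0.
  rewrite -[n.+1]addn1 window_cat morphism_cat size_cat [RHS]addnA -IHn.
  by rewrite window1 morphism_seq1 addnA addn1.
have winP i n : window w (pos i) (size (morphism m (window u i n)))
                = morphism m (window u i n).
  elim: n => [|n IHn] //.
  rewrite -[n.+1]addn1 window_cat morphism_cat size_cat window_cat IHn -posD.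
  by rewrite window1 morphism_seq1; have [-> _] := nextP _ (Qpos (i + n)).
exists u; first by apply: inf_morphism_eq => n; exact: (winP 0).
move=> i n /=; exists (pos i); split=> //; last by rewrite -posD.
by have := posD 0 i; rewrite add0n /= => ->; rewrite leq_addr.
Qed.

End Morphisms.

(** * Backtracking by extension to the left *)

Lemma infix_drop_cat (T : eqType) k (s t : seq T) : infix (drop k t ++ s) (t ++ s).
Proof. by apply: suffixW; rewrite suffix_catl // eqxx suffix_drop. Qed.

Section Search.
Variables (T : eqType) (letters : seq T).
Hypothesis lettersP : forall a, a \in letters.

(* Every extension of [s] to the left by [n] letters meets [goal] on the way. *)
Fixpoint search (goal : pred (seq T)) (n : nat) (s : seq T) : bool :=
  if goal s then true else
  if n is n'.+1 then all (fun a => search goal n' (a :: s)) letters else false.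

Lemma searchP goal n s t :
  search goal n s -> n <= size t -> exists k, goal (drop k t ++ s).
Proof.
elim: n s t => [|n IHn] s t /=.
  by case: ifP => // gs _ _; exists (size t); rewrite drop_size.
case: ifP => [gs _ _|_]; first by exists (size t); rewrite drop_size.
case/lastP: t => [|t a] // /allP/(_ a (lettersP a)) /IHn.
rewrite size_rcons ltnS => /[apply] -[k].
have [kt|tk] := leqP k (size t).
  by rewrite -cat_rcons -drop_rcons // => gk; exists k.
rewrite drop_oversize ?(ltnW tk) // => gk; exists (size t).
by rewrite drop_rcons // drop_size.
Qed.

End Search.

(** * Parikh vectors and proper words *)

Definition letters3 : seq 'I_3 := word3 [:: 0; 1; 2].

Lemma letters3P a : a \in letters3.
Proof. by case: a => [[|[|[|]]]]. Qed.

Lemma ord3P (P : 'I_3 -> Prop) : (forall a, a \in letters3 -> P a) -> forall a, P a.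
Proof. by move=> h a; apply/h/letters3P. Qed.

Lemma count_morphism (B : Type) (m : 'I_3 -> seq B) (p : pred B) s :
  count p (morphism m s) = \sum_(a : 'I_3) parikh s a * count p (m a).
Proof.
elim: s => [|b s IHs]; first by rewrite big1.
rewrite /morphism /= count_cat -/(morphism m s) IHs.
under [RHS]eq_bigr do rewrite /parikh /= mulnDl.
rewrite big_split /=; congr addn.
rewrite (bigD1 b) //= eqxx mul1n big1 ?addn0 // => a.
by rewrite eq_sym => /negPf ->.
Qed.

Lemma size_morphism (B : Type) (m : 'I_3 -> seq B) s :
  size (morphism m s) = \sum_(a : 'I_3) parikh s a * size (m a).
Proof. by rewrite -count_predT count_morphism; under eq_bigr do rewrite count_predT. Qed.

(** With [c] the block lengths, or the number of occurrences of a letter in each block, this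
    compares the images of [x] and [y] under a morphism. *)
Lemma parikh_gt_sum (c : 'I_3 -> nat) x y : parikh_gt x y -> (forall a, 0 < c a) ->
  \sum_(a : 'I_3) parikh y a * c a < \sum_(a : 'I_3) parikh x a * c a.
Proof.
move=> [le_yx [i lt_yx]] c_gt0; rewrite (bigD1 i) // [ltnRHS](bigD1 i) //=.
rewrite -addSn leq_add ?ltn_mul2r ?c_gt0 //.
by apply: leq_sum => j _; rewrite leq_mul2r le_yx orbT.
Qed.

Definition parikh_gtb (x y : seq 'I_3) : bool :=
  all (fun i => parikh y i <= parikh x i) letters3 &&
  has (fun i => parikh y i < parikh x i) letters3.

(** A computable necessary condition for [proper], so its failure refutes properness. In a factor
    [xyxyx] of a word of length l, [x] has length at most l/3 and [y] at most l/2; [x] is nonempty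
    because its Parikh vector is the larger one. *)
Definition properb (s : seq 'I_3) : bool :=
  all (fun v => ~~ infix v s) forbidden &&
  all (fun k => let t := drop k s in
    all (fun i => all (fun j =>
      let x := take i t in let y := take j (drop i t) in
      ~~ (prefix (x ++ y ++ x ++ y ++ x) t && parikh_gtb x y))
    (iota 0 (size t)./2.+1)) (iota 1 (size t %/ 3)))
  (iota 0 (size s)).

Lemma proper_properb s : proper s -> properb s.
Proof.
move=> [npow nforb]; apply/andP; split; first exact/allP.
apply/allP => k _; apply/allP => i _; apply/allP => j _ /=.
apply/negP => /andP[pre /andP[/allP le_yx /hasP[a _ lt_yx]]].
apply: (npow (take i (drop k s)) (take j (drop i (drop k s)))).
  exact: infix_trans (prefixW pre) (infix_drop _ _).
by split; [move=> b; exact/le_yx/letters3P | exists a].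
Qed.

Lemma proper_infix s t : infix s t -> proper t -> proper s.
Proof.
move=> st [npow nforb]; split=> [x y /infix_trans/(_ st)/npow //|v /nforb].
by apply: contra => /infix_trans; exact.
Qed.

(** * Preimages under [f] and [h] *)

Lemma morphism_infix (A B : eqType) (m : A -> seq B) s t :
  infix s t -> infix (morphism m s) (morphism m t).
Proof. by move=> /infixP[a [b ->]]; rewrite !morphism_cat infix_infix. Qed.

(** Every block starts with [b0], so the image of [v] is followed by [b0] whether or not [b] is
    empty. *)
Lemma morphism_context (A B : eqType) (m : A -> seq B) (b0 : B) t a v b :
  (forall c, m c = b0 :: behead (m c)) ->
  infix ((t ++ morphism m a) ++ morphism m v ++ [:: b0])
        (t ++ morphism m (a ++ v ++ b) ++ [:: b0]).
Proof.
move=> m0; rewrite !morphism_cat; case: b => [|c b]; first by rewrite cats0 -!catA infix_refl.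
rewrite -[c :: b]cat1s morphism_cat morphism_seq1 m0 -!catA.
apply/infixP; exists [::], (behead (m c) ++ morphism m b ++ [:: b0]).
by rewrite /= -!catA.
Qed.

Lemma f_letter0 a : f_letter a == ord0 :: behead (f_letter a).
Proof. by move: a; apply: ord3P; apply/allP. Qed.

Lemma f_forbidden_dead :
  all (fun v => search letters3 (predC properb) 3 (morphism f_letter v ++ [:: ord0]))
    forbidden.
Proof. by vm_compute. Qed.

Lemma proper_of_f t s : 2 < size t ->
  proper (t ++ morphism f_letter s ++ [:: ord0]) -> proper s.
Proof.
move=> t3 Ps; have fin u : infix u s -> infix (morphism f_letter u)
    (t ++ morphism f_letter s ++ [:: ord0]).
  by move=> /(morphism_infix f_letter) us; apply/infix_catl/infix_catr.
split=> [x y /fin|v vforb].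
  rewrite !morphism_cat => /(proj1 Ps) npow gt_xy; apply: npow; split=> [i|].
    rewrite /parikh !count_morphism leq_sum // => a _.
    by rewrite leq_mul2r (proj1 gt_xy) orbT.
  (* The letter 1 occurs in each of the blocks 0121, 021 and 01, so all weights are positive. *)
  exists (inZp 1); rewrite /parikh !count_morphism.
  by apply: parikh_gt_sum gt_xy _; apply: ord3P; apply/allP.
apply/negP => /infixP[a [b es]].
have Pv : proper ((t ++ morphism f_letter a) ++ morphism f_letter v ++ [:: ord0]).
  apply: proper_infix Ps; rewrite es; apply: morphism_context => c; exact/eqP/f_letter0.
have /allP/(_ _ vforb) dead := f_forbidden_dead.
have [|k /negP[]] := searchP letters3P (t := t ++ morphism f_letter a) dead.
  by rewrite size_cat; exact: leq_trans t3 (leq_addr _ _).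
apply: proper_properb; apply: proper_infix Pv.
exact: infix_drop_cat.
Qed.

Lemma rev_h_letter a : rev (h_letter a) == f_letter a.
Proof. by move: a; apply: ord3P; apply/allP. Qed.

Lemma rev_morphism_h s : rev (morphism h_letter s) = morphism f_letter (rev s).
Proof.
elim: s => // a s IHs; rewrite rev_cons -cats1 morphism_cat morphism_seq1 -IHs.
by rewrite -[a :: s]cat1s morphism_cat morphism_seq1 rev_cat (eqP (rev_h_letter a)).
Qed.

(** The search from the empty word runs through all words of length 6; the size test in [goal] lets
    it stop earlier only at improper words. Length 5 would not do: 01212 is proper and has no prefix
    [f(a)0]. *)
Lemma f_parse s : proper s -> size s = 6 ->
  ord0 \in s /\ (head (inZp 1) s = ord0 -> exists a, prefix (f_letter a ++ [:: ord0]) s).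
Proof.
pose goal s := ~~ properb s || [&& size s == 6, ord0 \in s &
  (head (inZp 1) s == ord0) ==> has (fun a => prefix (f_letter a ++ [:: ord0]) s) letters3].
move=> Ps s6; have : search letters3 goal 6 [::] by vm_compute.
move=> /(searchP letters3P (t := s)); rewrite s6 => /(_ isT)[k]; rewrite cats0.
case/orP => [/negP[]|].
  exact: proper_properb (proper_infix (infix_drop _ _) Ps).
rewrite size_drop s6 => /and3P[/eqP k6]; have -> : k = 0 by lia.
rewrite drop0 => -> /implyP impl.
by split=> // /eqP/impl/hasP[a _ pre]; exists a.
Qed.

(** Blocks of [h] end in 0, so a cut is recognised by the letter before it; hence the prefix
    [0h(a)]. *)
Lemma h_parse s : antiproper s -> size s = 6 -> 
  ord0 \in s /\ (head (inZp 1) s = ord0 -> exists a, prefix (ord0 :: h_letter a) s).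
Proof.
pose goal s := ~~ properb (rev s) || [&& size s == 6, ord0 \in s &
  (head (inZp 1) s == ord0) ==> has (fun a => prefix (ord0 :: h_letter a) s) letters3].
move=> Ps s6; have : search letters3 goal 6 [::] by vm_compute.
move=> /(searchP letters3P (t := s)); rewrite s6 => /(_ isT)[k]; rewrite cats0.
case/orP => [/negP[]|].
  by apply/proper_properb/(proper_infix _ Ps); rewrite infix_rev infix_drop.
rewrite size_drop s6 => /and3P[/eqP k6]; have -> : k = 0 by lia.
rewrite drop0 => -> /implyP impl.
by split=> // /eqP/impl/hasP[a _ pre]; exists a.
Qed.

Lemma window_prefix (A : eqType) (w : infword A) k n s :
  prefix s (window w k n) -> window w k (size s) = s.
Proof.
move=> /prefixP[r e]; have := congr1 size e; rewrite size_window size_cat => en.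
move/eqP: e; rewrite en window_cat eqseq_cat ?size_window // => /andP[/eqP e _].
exact: e.
Qed.

Lemma head_window (A : eqType) (w : infword A) x0 k n : head x0 (window w k n.+1) = w k.
Proof. by rewrite -nth0 nth_window // addn0. Qed.

Lemma window_has (A : eqType) (w : infword A) k n a :
  a \in window w k n -> exists2 j, k <= j & w j = a.
Proof.
move=> ain; exists (k + index a (window w k n)); first exact: leq_addr.
have lt_n : index a (window w k n) < n by rewrite -[ltnRHS](size_window w k) index_mem.
by rewrite -(nth_window w a k lt_n) nth_index.
Qed.

Lemma f_letter_gt0 a : 0 < size (f_letter a).
Proof. by move: a; apply: ord3P; apply/allP. Qed.

Lemma h_letter_gt0 a : 0 < size (h_letter a).
Proof. by move: a; apply: ord3P; apply/allP. Qed.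

Lemma last_h_letter a : last ord0 (h_letter a) == ord0.
Proof. by move: a; apply: ord3P; apply/allP. Qed.

Lemma inf_properP u : inf_proper u <-> forall s, lang u s -> proper s.
Proof.
split=> Pu => [s us|n s /factors_lang[us _]]; last exact: Pu.
by apply: (Pu (size s)); apply/factors_lang.
Qed.

Lemma inf_antiproperP u : inf_antiproper u <-> forall s, lang u s -> antiproper s.
Proof.
split=> Pu => [s us|n s /factors_lang[us _]]; last exact: Pu.
by apply: (Pu (size s)); apply/factors_lang.
Qed.

Lemma f_desubstitution u : inf_proper u ->
  exists k v, inf_proper v /\ final_segment k u = f v.
Proof.
(* Cuts are the zeros with three letters to their left, the context that [proper_of_f] asks for. *)
move=> /inf_properP Pu; pose Q k := (2 < k) && (u k == ord0).
have [k0 k0_ge uk0] : exists2 k0, 3 <= k0 & u k0 = ord0.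
  have [h0 _] := f_parse (Pu _ (window_lang u 3 6)) (size_window _ _ _).
  exact: window_has h0.
have [|k Qk|v ev Pv] := desubstitution ord0 f_letter_gt0 (Q := Q) (w := u) (k0 := k0).
- by rewrite /Q k0_ge uk0 eqxx.
- have /andP[k_ge /eqP uk] := Qk.
  have [_] := f_parse (Pu _ (window_lang u k 6)) (size_window _ _ _).
  rewrite head_window => /(_ uk)[a /window_prefix].
  rewrite size_cat window_cat => /eqP; rewrite eqseq_cat ?size_window // window1.
  move=> /andP[/eqP wa /eqP[ua]]; exists a => //.
  by rewrite /Q ua eqxx (leq_trans k_ge) ?leq_addr.
exists k0, v; split=> // n _ [i _ <-]; rewrite -/(window v i n).
have [j [_ /andP[j_ge _] /andP[_ /eqP uj] wj]] := Pv i n.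
apply: (@proper_of_f (window u (j - 3) 3)); first by rewrite size_window.
have := window_lang u (j - 3) (3 + (size (morphism f_letter (window v i n)) + 1)).
by rewrite !window_cat subnK // wj window1 uj => /Pu.
Qed.

Lemma h_desubstitution u : inf_antiproper u ->
  exists k v, inf_antiproper v /\ final_segment k u = h v.
Proof.
move=> /inf_antiproperP Pu; pose Q k := (0 < k) && (u k.-1 == ord0).
have [k0 _ uk0] : exists2 k0, 0 <= k0 & u k0 = ord0.
  have [h0 _] := h_parse (Pu _ (window_lang u 0 6)) (size_window _ _ _).
  exact: window_has h0.
have [|k Qk|v ev Pv] := desubstitution ord0 h_letter_gt0 (Q := Q) (w := u) (k0 := k0.+1).
- by rewrite /Q /= uk0 eqxx.
- case: k Qk => // k /= /eqP uk.
  have [_] := h_parse (Pu _ (window_lang u k 6)) (size_window _ _ _).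
  rewrite head_window => /(_ uk)[a /window_prefix].
  rewrite /= => wa.
  have ulast : u (k + size (h_letter a)) = ord0.
    rewrite -(nth_window u ord0 k (ltnSn _)) wa.
    exact: etrans (nth_last ord0 (ord0 :: h_letter a)) (eqP (last_h_letter a)).
  move: wa; rewrite -[(size _).+1]add1n window_cat window1 addn1 => -[_ wa].
  by exists a; rewrite // /Q addSn ulast eqxx.
exists k0.+1, v; split=> // n _ [i _ <-]; rewrite -/(window v i n).
have [j [_ /andP[j_gt0 /eqP uj] _ wj]] := Pv i n.
(* After reversal the three letters to the right become the left context of [proper_of_f], and the 0
   before the image becomes its final 0. *)
have := window_lang u j.-1 (1 + (size (morphism h_letter (window v i n)) + 3)).
rewrite !window_cat window1 uj addn1 prednK // wj => /Pu.
rewrite /antiproper /= rev_cons -cats1 rev_cat rev_morphism_h -catA.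
by apply: proper_of_f; rewrite size_rev size_window.
Qed.

(** * Languages with few factors and no large powers *)

Lemma card_le_seq (T : eqType) (x0 : T) (A : set T) (m : nat) (s : seq T) :
  A #= `I_m -> (forall x, A x -> x \in s) -> m <= size s.
Proof.
move=> cA As; rewrite -card_le_II -(card_le_eql cA).
apply: card_le_trans (card_image_le (nth x0 s) _).
by apply: subset_card_le => x /As xs; exists (index x s); rewrite /= ?index_mem ?nth_index.
Qed.

(* Stated for languages so that it also applies to the reversed factors of an
   infinite word, which has no reversal. *)
Record optimal (P : seq bool -> Prop) : Prop := Optimal {
  optimal_infix : forall s t, infix s t -> P t -> P s;
  optimal_period : forall s p, P s -> is_period s p -> 2 * size s <= 5 * p;
  optimal_count : forall n X, 0 < n -> uniq X ->
    (forall s, s \in X -> P s /\ size s = n) -> size X <= 2 * n }.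

(** Any period is at least the smallest one, so the bound on the exponent passes to all periods. *)
Lemma optimal_lang w : Rote w -> avoids_plus_powers (5%:R / 2%:R)%R w -> optimal (lang w).
Proof.
move=> rw aw; split=> [s t|s p ws per|n X n_gt0 uX XP]; first exact: lang_infix.
- have /andP[p_gt0 _] := per.
  have /negP := aw (size s) s (proj2 (factors_lang _ _ _) (conj ws erefl)).
  rewrite /exponent /smallest_period; case: ex_minnP => q /andP[q_gt0 _] /(_ p per) le_qp.
  rewrite -Order.TotalTheory.leNgt.
  rewrite Num.Theory.ler_pdivrMr ?Num.Theory.ltr0n // GRing.mulrAC.
  rewrite Num.Theory.ler_pdivlMr ?Num.Theory.ltr0n // -!GRing.natrM Num.Theory.ler_nat.
  by move=> le5; rewrite mulnC (leq_trans le5) // leq_mul2l.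
- by apply: uniq_card_le (rw n n_gt0) uX _ => s /XP/factors_lang.
Qed.

Lemma is_period_rev (T : eqType) (s : seq T) p : is_period (rev s) p = is_period s p.
Proof.
rewrite /is_period; case: p => //= p; rewrite size_rev drop_rev.
rewrite take_rev (inj_eq (can_inj revK)) eq_sym; congr (_ == _).
have [le|lt] := leqP p.+1 (size s); first by rewrite subKn.
by rewrite !drop_oversize //; lia.
Qed.

Lemma is_period_map (T U : eqType) (c : T -> U) (s : seq T) p :
  injective c -> is_period (map c s) p = is_period s p.
Proof.
by move=> c_inj; rewrite /is_period size_map -map_drop -map_take (inj_eq (inj_map c_inj)).
Qed.

(** Serves both symmetries, reversal and letterwise complement. *)
Lemma optimal_comp P (c : seq bool -> seq bool) : optimal P ->
  (forall s t, infix s t -> infix (c s) (c t)) -> injective c ->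
  (forall s, size (c s) = size s) -> (forall s p, is_period s p -> is_period (c s) p) ->
  optimal (P \o c).
Proof.
move=> [Pinf Pper Pcount] c_inf c_inj c_size c_per.
split=> [s t /c_inf|s p /= /Pper Ps /c_per/Ps|n X n_gt0 uX XP]; first exact: Pinf.
- by rewrite c_size.
- rewrite -(size_map c); apply: Pcount; rewrite ?map_inj_uniq // => _ /mapP[s /XP[? <-] ->].
  by rewrite c_size.
Qed.

Lemma optimal_rev P : optimal P -> optimal (P \o rev).
Proof.
move=> oP; apply: optimal_comp => //; first by move=> s t; rewrite infix_rev.
- exact: can_inj revK.
- exact: size_rev.
- by move=> s p; rewrite is_period_rev.
Qed.

Definition factors_of (n : nat) (s : seq bool) : seq (seq bool) :=
  [seq take n (drop k s) | k <- iota 0 ((size s).+1 - n)].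

(** Here [l] is the least length for which period [p] gives an exponent above 5/2. Only prefixes are
    tested for powers: [search] adds letters on the left and has already tested the shorter words it
    built. *)
Definition sparse_powerfree (ns : seq nat) (s : seq bool) : bool :=
  all (fun n => size (undup (factors_of n s)) <= 2 * n) ns &&
  all (fun p => let l := (5 * p)./2.+1 in
    if l <= size s then take (l - p) (drop p s) != take (l - p) s else true)
  (iota 1 (size s)./2).

Lemma factors_ofP n s x : x \in factors_of n s -> infix x s /\ size x = n.
Proof.
move=> /mapP[k]; rewrite mem_iota add0n /= => ltk ->; split.
  exact: infix_trans (infix_take _ _) (infix_drop _ _).
by rewrite size_takel // size_drop; lia.
Qed.

Lemma optimal_sparse_powerfree P ns s :
  optimal P -> all (leq 1) ns -> P s -> sparse_powerfree ns s.
Proof.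
move=> [Pinf Pper Pcount] /allP ns_gt0 Ps; apply/andP; split; apply/allP.
  move=> n /ns_gt0 n_gt0; apply: Pcount n_gt0 (undup_uniq _) _ => x.
  rewrite mem_undup => /factors_ofP[xs <-].
  by split=> //; exact: Pinf xs Ps.
move=> p; rewrite mem_iota => /andP[p_gt0 _] /=; case: ifP => //; set l := _.+1 => le_l.
apply/negP => /eqP e.
have le_pl : p <= l by rewrite /l; lia.
have : is_period (take l s) p.
  rewrite /is_period p_gt0 size_takel // take_takel ?leq_subr //.
  by rewrite -e take_drop subnK //= eqxx.
move/(Pper _ _ (Pinf _ _ (infix_take _ _) Ps)); rewrite size_takel // /l; lia.
Qed.

(** * The four possible sets of factors of length 4 *)

Definition letters2 : seq bool := [:: false; true].

Lemma letters2P b : b \in letters2.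
Proof. by case: b. Qed.

Definition F_seq : seq (seq bool) :=
  map word2 [:: [:: 0; 1; 1; 0]; [:: 1; 0; 0; 1]; [:: 0; 0; 1; 1]; [:: 1; 1; 0; 0];
                [:: 0; 0; 1; 0]; [:: 0; 1; 0; 0]; [:: 1; 1; 0; 1]; [:: 1; 0; 1; 0]].

Definition F_variants : seq (seq (seq bool)) :=
  [:: F_seq; map (map negb) F_seq; map rev F_seq; map (map negb) (map rev F_seq)].

(* Words are read from right to left by [search], so this is applied to reversed
   factors; [F_variants] is closed under reversal. *)
Definition extremal_or_variant (s : seq bool) : bool :=
  ~~ sparse_powerfree [:: 4; 8] s || has (all (fun x => x \in factors_of 4 s)) F_variants.

Lemma search_extremal_or_variant : search letters2 extremal_or_variant 50 [:: false; false].
Proof. by vm_compute. Qed.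

Lemma factors4_variant w : Rote w -> avoids_plus_powers (5%:R / 2%:R)%R w ->
  exists2 X, X \in F_variants & factors w 4 = [set` X].
Proof.
move=> rw aw; have oP := optimal_lang rw aw.
(* Without 00 at most three words of length 2 could occur, but a Rote word has four. *)
have [k wk] : exists k, window w k 2 = [:: false; false].
  apply: contrapT => no00; suff: 4 <= 3 by [].
  apply: (card_le_seq (s := [:: [:: false; true]; [:: true; false]; [:: true; true]])
    [::] (rw 2 isT)) => _ [k _ <-].
  have : window w k 2 <> [:: false; false] by move=> wk; apply: no00; exists k.
  rewrite -/(window w k 2) -[2]/(1 + 1) window_cat !window1.
  by case: (w k); case: (w _).
have := window_lang w k (2 + 50); rewrite window_cat wk => wt.
have [|i] := searchP letters2P (t := rev (window w (k + 2) 50)) search_extremal_or_variant.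
  by rewrite size_rev size_window.
set s := _ ++ _; have ws : (lang w \o rev) s.
  apply: (optimal_infix (optimal_rev oP)) (infix_drop_cat _ _ _) _.
  by move: wt; rewrite -[X in lang w X]revK rev_cat.
case/orP => [/negP[]|/hasP[X Xin /allP Xs]].
  exact: optimal_sparse_powerfree (optimal_rev oP) _ ws.
(* The search ran on a reversed factor, so the words found in it are reversed back. *)
pose Y := map rev X; have [Yin uY sY] : [/\ Y \in F_variants, uniq Y & size Y = 8].
  have /allP/(_ X Xin)/and3P[-> -> /eqP->] : all (fun X => [&& map rev X \in F_variants,
    uniq (map rev X) & size (map rev X) == 8]) F_variants by vm_compute.
  by [].
have Yw x : x \in Y -> factors w 4 x.
  move=> /mapP[y /Xs/factors_ofP[ys y4] ->]; apply/factors_lang; rewrite size_rev.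
  by split=> //; apply: (optimal_infix oP) ws; rewrite infix_rev.
exists Y => //; apply/seteqP; split=> [x wx|x /Yw//]; apply/negPn/negP => nYx.
(* A further factor [x] would be a ninth one of length 4. *)
suff : size (x :: Y) <= 2 * 4 by rewrite /= sY.
apply: uniq_card_le (rw 4 isT) _ _; first by rewrite /= uY andbT.
by move=> y; rewrite inE => /orP[/eqP->|/Yw].
Qed.

(** * Preimages under [g] *)

Lemma g_letter0 a : g_letter a == false :: behead (g_letter a).
Proof. by move: a; apply: ord3P; apply/allP. Qed.

Lemma g_letter_gt0 a : 0 < size (g_letter a).
Proof. by rewrite (eqP (g_letter0 a)). Qed.

Definition sparse_powerfree_in_F (s : seq bool) : bool :=
  sparse_powerfree [:: 6] s && all (fun x => x \in F_seq) (factors_of 4 s).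

(** Depth 31 covers all seven forbidden words at once; it fixes the length of the context in
    [proper_of_g]. *)
Lemma g_forbidden_dead :
  all (fun v => search letters2 (predC sparse_powerfree_in_F) 31
    (morphism g_letter v ++ [:: false])) forbidden.
Proof. by vm_compute. Qed.

Lemma is_period_xyxyx (T : eqType) (x y : seq T) : 0 < size x ->
  is_period (x ++ y ++ x ++ y ++ x) (size (x ++ y)).
Proof.
move=> x_gt0; rewrite /is_period size_cat addn_gt0 x_gt0 /=.
have -> : drop (size x + size y) (x ++ y ++ x ++ y ++ x) = x ++ y ++ x.
  by rewrite -size_cat catA drop_size_cat.
have -> : size (x ++ y ++ x ++ y ++ x) - (size x + size y) = size (x ++ y ++ x).
  by rewrite !size_cat; lia.
have -> : x ++ y ++ x ++ y ++ x = (x ++ y ++ x) ++ y ++ x by rewrite -!catA.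
by rewrite take_size_cat.
Qed.

(** Stated for a language [P] so as to apply to the factors of [w] and to their reversals. *)
Lemma proper_of_g P t s : optimal P -> (forall x, P x -> size x = 4 -> x \in F_seq) ->
  30 < size t -> P (t ++ morphism g_letter s ++ [:: false]) -> proper s.
Proof.
move=> oP PF t31 Ps; split=> [x y|v vforb].
  move=> /(morphism_infix g_letter); rewrite !morphism_cat.
  set a := morphism g_letter x; set b := morphism g_letter y => xys gt_xy.
  have lt_ba : size b < size a.
    by rewrite !size_morphism; apply: parikh_gt_sum gt_xy g_letter_gt0.
  have Pxy : P (a ++ b ++ a ++ b ++ a).
    by apply: (optimal_infix oP) Ps; apply/infix_catl/infix_catr.
  have /(optimal_period oP Pxy) : is_period (a ++ b ++ a ++ b ++ a) (size (a ++ b)).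
    by apply: is_period_xyxyx; exact: leq_ltn_trans lt_ba.
  (* The period bound reads 2(3|a| + 2|b|) <= 5(|a| + |b|), that is |a| <= |b|. *)
  by rewrite !size_cat; lia.
apply/negP => /infixP[a [b es]].
have Pv : P ((t ++ morphism g_letter a) ++ morphism g_letter v ++ [:: false]).
  apply: (optimal_infix oP) Ps; rewrite es; apply: morphism_context => c; exact/eqP/g_letter0.
have /allP/(_ _ vforb) dead := g_forbidden_dead.
have [|k /negP[]] := searchP letters2P (t := t ++ morphism g_letter a) dead.
  by rewrite size_cat; exact: leq_trans t31 (leq_addr _ _).
have Pk := optimal_infix oP (infix_drop_cat k _ _) Pv.
rewrite /sparse_powerfree_in_F (optimal_sparse_powerfree oP) //=.
apply/allP => x /factors_ofP[/(optimal_infix oP) Px x4].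
exact: PF (Px Pk) x4.
Qed.

(** Four letters suffice to see a block and the next 0, the longest such word being 0110. The test
    succeeds for F and for its reversal. *)
Definition g_parsable (X : seq (seq bool)) : bool :=
  all (fun s => (false \in s) &&
    (head true s || has (fun a => prefix (g_letter a ++ [:: false]) s) letters3)) X.

(** [K] reserves letters to the left of every image: 31 for proper preimages, none for antiproper
    ones, whose context lies to the right. *)
Lemma g_desubstitution w X K : factors w 4 = [set` X] -> g_parsable X ->
  exists k u, final_segment k w = g u /\
  forall i n, let s := morphism g_letter (window u i n) in
  exists2 j, K <= j & window w j (size s + 1) = s ++ [:: false].
Proof.
move=> wX /allP parse; have inX k : window w k 4 \in X.
  by have : factors w 4 (window w k 4) by [exists k]; rewrite wX.
pose Q k := ~~ w k.
have [k0 k0_ge wk0] : exists2 k0, K <= k0 & w k0 = false.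
  by have /andP[/window_has h0 _] := parse _ (inX K).
have [||u eu Pu] := desubstitution false g_letter_gt0 (Q := Q) (w := w) (k0 := k0).
- by rewrite /Q wk0.
- move=> k /negPf wk; have /andP[_] := parse _ (inX k); rewrite head_window wk.
  move=> /hasP[a _ /window_prefix].
  rewrite size_cat window_cat => /eqP; rewrite eqseq_cat ?size_window // window1.
  by move=> /andP[/eqP wa /eqP[wka]]; exists a; rewrite // /Q wka.
exists k0, u; split=> // i n; have [j [le_j _ /negPf wj ej]] := Pu i n.
by exists j; [exact: leq_trans le_j | rewrite window_cat ej window1 wj].
Qed.

Lemma g_proper w : optimal (lang w) -> factors w 4 = F ->
  exists k u, inf_proper u /\ final_segment k w = g u.
Proof.
move=> oP wF; have [|k [u [eu Pu]]] := @g_desubstitution w F_seq 31 wF; first by vm_compute.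
exists k, u; split=> // n _ [i _ <-]; rewrite -/(window u i n).
have [j j_ge ej] := Pu i n; apply: (proper_of_g (t := window w (j - 31) 31) oP).
- by move=> x wx x4; have : factors w 4 x by [apply/factors_lang]; rewrite wF.
- by rewrite size_window.
- by rewrite -ej -{2}(subnK j_ge) -window_cat; exact: window_lang.
Qed.

(** For each letter a, 0 followed by the reversal of g(a) equals g(a)0, so a 0 can be moved through
    the word block by block. *)
Lemma rev_morphism_g s :
  rev (morphism g_letter (rev s) ++ [:: false]) = morphism g_letter s ++ [:: false].
Proof.
rewrite rev_cat /=; elim: s => // a s IHs.
rewrite rev_cons -cats1 morphism_cat morphism_seq1 rev_cat -cat_cons.
have /eqP-> : false :: rev (g_letter a) == g_letter a ++ [:: false].
  by move: a; apply: ord3P; apply/allP.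
by rewrite -catA /= IHs catA -[a :: s]cat1s morphism_cat morphism_seq1.
Qed.

Lemma image_seq (T U : eqType) (c : T -> U) (X : seq T) :
  c @` [set` X] = [set` map c X].
Proof.
apply/seteqP; split=> [_ [y yX <-]|x xX]; first by apply/mapP; exists y.
by have /mapP[y yX ->] : x \in map c X := xX; exists y.
Qed.

Lemma g_antiproper w : optimal (lang w) -> factors w 4 = reversals F ->
  exists k u, inf_antiproper u /\ final_segment k w = g u.
Proof.
move=> oP; have -> : reversals F = [set` map rev F_seq] by exact: image_seq.
move=> wF.
have [|k [u [eu Pu]]] := @g_desubstitution w _ 0 wF; first by vm_compute.
exists k, u; split=> // n _ [i _ <-]; rewrite -/(window u i n).
have [j _ ej] := Pu i n.
set s := window u i n in ej *; set l := size _ in ej.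
(* In the reversed language the 31 letters following the image stand on its left, and the length-4
   factors lie in F. *)
apply: (proper_of_g (t := rev (window w (j + (l + 1)) 31)) (optimal_rev oP)).
- move=> x wx x4; rewrite -(mem_map (can_inj revK)).
  have : factors w 4 (rev x) by apply/factors_lang; rewrite size_rev.
  by rewrite wF.
- by rewrite size_rev size_window.
- rewrite -[(_ \o _) _]/(lang w (rev _)) rev_cat revK rev_morphism_g -ej -window_cat.
  exact: window_lang.
Qed.

(** * Iteration, complementation and the four cases *)

Lemma final_final (A : Type) (w : infword A) j k :
  final_segment j (final_segment k w) = final_segment (k + j) w.
Proof. by apply/funext => i; rewrite /final_segment addnA. Qed.

Lemma iter_desubstitution (m : 'I_3 -> seq 'I_3) (Pr : infword 'I_3 -> Prop) w :
  (forall a, 0 < size (m a)) ->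
  (forall u, Pr u -> exists k v, Pr v /\ final_segment k u = inf_morphism ord0 m v) ->
  (exists k u, Pr u /\ final_segment k w = g u) ->
  forall n, exists k u, Pr u /\ final_segment k w = g (iter n (inf_morphism ord0 m) u).
Proof.
move=> m_gt0 desub w0; elim=> // n [k [u [Pu ew]]].
have [j [v [Pv eu]]] := desub u Pu.
(* Dropping a prefix of [u] drops its image at each level of the iteration. *)
have [i ei] : exists i, final_segment i (iter n (inf_morphism ord0 m) u)
    = iter n (inf_morphism ord0 m) (final_segment j u).
  elim: n {ew} => [|n [i IHn]]; first by exists j.
  by rewrite /= -IHn; eexists; exact: final_inf_morphism.
have [i' ei'] : exists i', final_segment i' (g (iter n (inf_morphism ord0 m) u))
    = g (iter n.+1 (inf_morphism ord0 m) v).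
  rewrite iterSr -eu -ei; eexists; exact: (final_inf_morphism false g_letter_gt0).
by exists (k + i'), v; split; rewrite // -final_final ew.
Qed.

Lemma factors_complement w n : factors (complement w) n = complements (factors w n).
Proof.
have e k : window (complement w) k n = map negb (window w k n).
  by rewrite /window /infprefix /mkseq -map_comp.
apply/seteqP; split=> [s [k _ <-]|_ [_ [k _ <-] <-]]; last first.
  by exists k => //; exact: e.
by exists (window w k n); [exists k | rewrite -e].
Qed.

Lemma complementK w : complement (complement w) = w.
Proof. by apply/funext => i; exact: negbK. Qed.

Lemma lang_complement w s : lang (complement w) s -> lang w (map negb s).
Proof.
move=> ws; have : factors (complement w) (size s) s by apply/factors_lang.
by rewrite factors_complement => -[t /factors_lang[wt _] <-]; rewrite (mapK negbK).
Qed.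

Lemma optimal_complement w : optimal (lang w) -> optimal (lang (complement w)).
Proof.
suff -> : lang (complement w) = lang w \o map negb.
  move=> /optimal_comp; apply=> [s t /infixP[a [b ->]]||s|s p].
  - by rewrite !map_cat infix_infix.
  - exact: inj_map (can_inj negbK).
  - exact: size_map.
  - by rewrite is_period_map //; exact: can_inj negbK.
apply/funext => s; apply/propext; split=> [|/= ws]; first exact: lang_complement.
by rewrite -(mapK negbK s); apply: lang_complement; rewrite complementK.
Qed.

Lemma complement_final k w : final_segment k (complement w) = complement (final_segment k w).
Proof. by []. Qed.

Lemma complementsK (S : set (seq bool)) : complements (complements S) = S.
Proof.
apply/seteqP; split=> [_ [_ [s Ss <-] <-]|s Ss]; first by rewrite (mapK negbK).
by exists (map negb s); [exists s | exact: mapK negbK s].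
Qed.

Lemma variants_disjoint (X Y : seq (seq bool)) :
  ~~ all (fun x => x \in Y) X -> [set` X] <> [set` Y].
Proof.
by move=> /allP nXY eXY; apply: nXY => x xX; have : [set` X] x by []; rewrite eXY.
Qed.

Theorem theorem2 (w : infword bool)
    (hRote : Rote w) (hpow : avoids_plus_powers (5%:R / 2%:R)%R w) :
  exactly_one_of_four
    (factors w 4 = F /\
     forall n, 0 < n -> exists (k : nat) (u : infword 'I_3),
       inf_proper u /\ final_segment k w =1 g (iter n f u))
    (factors w 4 = complements F /\
     forall n, 0 < n -> exists (k : nat) (u : infword 'I_3),
       inf_proper u /\ final_segment k w =1 complement (g (iter n f u)))
    (factors w 4 = reversals F /\
     forall n, 0 < n -> exists (k : nat) (u : infword 'I_3),
       inf_antiproper u /\ final_segment k w =1 g (iter n h u))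
    (factors w 4 = complements (reversals F) /\
     forall n, 0 < n -> exists (k : nat) (u : infword 'I_3),
       inf_antiproper u /\ final_segment k w =1 complement (g (iter n h u))).
Proof.
have oP := optimal_lang hRote hpow; have oPc := optimal_complement oP.
have itf := iter_desubstitution f_letter_gt0 f_desubstitution.
have ith := iter_desubstitution h_letter_gt0 h_desubstitution.
have eC : complements F = [set` map (map negb) F_seq] by exact: image_seq.
have eR : reversals F = [set` map rev F_seq] by exact: image_seq.
have eCR : complements (reversals F) = [set` map (map negb) (map rev F_seq)].
  by rewrite eR; exact: image_seq.
(* The four sets of length-4 factors are pairwise distinct, which already makes the cases
   exclusive. *)
split; last first.
  rewrite eCR eC eR; do !split; move=> [[e1 _] [e2 _]]; move: e2; rewrite e1;
  by apply: variants_disjoint; vm_compute.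
have [X] := factors4_variant hRote hpow.
rewrite !inE => /or4P[] /eqP-> wX.
- left; split=> // n _; have [k [u [Pu e]]] := itf w (g_proper oP wX) n.
  by exists k, u; split=> // i; rewrite e.
- right; left; rewrite eC; split=> // n _.
  (* The case of F is applied to the complement of [w], and the result is complemented back. *)
  have wcX : factors (complement w) 4 = F by rewrite factors_complement wX -eC complementsK.
  have [k [u [Pu e]]] := itf _ (g_proper oPc wcX) n.
  by exists k, u; split=> // i; rewrite -[g _]e complement_final complementK.
- right; right; left; rewrite eR; split=> // n _; rewrite -eR in wX.
  have [k [u [Pu e]]] := ith w (g_antiproper oP wX) n.
  by exists k, u; split=> // i; rewrite e.
- right; right; right; rewrite eCR; split=> // n _.
  have wcX : factors (complement w) 4 = reversals F.
    by rewrite factors_complement wX -eCR complementsK.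
  have [k [u [Pu e]]] := ith _ (g_antiproper oPc wcX) n.
  by exists k, u; split=> // i; rewrite -[g _]e complement_final complementK.
Qed.
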